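(* Let $A\in\mathbb{R}^{n\times n}$ be symmetric positive definite (SPD), let $M\in\mathbb{R}^{n\times n}$ be nonsingular with $M+M^{T}-A$ SPD, let $P\in\mathbb{R}^{n\times n_{\rm c}}$ ($n_{\rm c}<n$) have full column rank $n_{\rm c}$, let $A_{\rm c}=P^{T}AP$, and let $B_{\rm c}\in\mathbb{R}^{n_{\rm c}\times n_{\rm c}}$ be SPD. Let $E_{\rm ITG}=(I-M^{-T}A)(I-PB_{\rm c}^{-1}P^{T}A)(I-M^{-1}A)$ be the iteration matrix of the inexact two-grid method, and let $$r_{1}=\lambda_{\min}(B_{\rm c}^{-1}A_{\rm c}),\qquad r_{2}=\lambda_{\max}(B_{\rm c}^{-1}A_{\rm c}).$$ With $\widetilde{M}$, $\Pi_{A}$ and $K_{\rm TG}$ as defined in the context, the convergence factor $\|E_{\rm ITG}\|_{A}$ satisfies the following estimates. (i) If $r_{2}\leq 1$, then $\mathscr{L}_{1}\leq\|E_{\rm ITG}\|_{A}\leq\mathscr{U}_{1}$, where $$\mathscr{L}_{1}=1-\min\left\{\frac{1}{K_{\rm TG}},\ \lambda_{\min}(\widetilde{M}^{-1}A)+r_{2}\big(1-\lambda_{\min}^{+}(\widetilde{M}^{-1}A\Pi_{A})\big)\right\},$$ $$\mathscr{U}_{1}=1-\frac{r_{1}}{K_{\rm TG}}-(1-r_{1})\lambda_{\min}(\widetilde{M}^{-1}A).$$ (ii) If $r_{1}\leq 1<r_{2}$, then $\mathscr{L}_{2}\leq\|E_{\rm ITG}\|_{A}\leq\max\{\mathscr{U}_{1},\mathscr{U}_{2}\}$,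 where $\mathscr{U}_1$ is given by the same formula as in (i) and $$\mathscr{L}_{2}=1-\min\left\{\lambda_{\max}(\widetilde{M}^{-1}A),\ \frac{r_{2}}{K_{\rm TG}}-(r_{2}-1)\lambda_{\min}(\widetilde{M}^{-1}A)\right\},$$ $$\mathscr{U}_{2}=(r_{2}-1)\big(1-\lambda_{\min}^{+}(\widetilde{M}^{-1}A\Pi_{A})\big).$$ (iii) If $1<r_{1}$, then $\max\{\mathscr{L}_{2},\mathscr{L}_{3}\}\leq\|E_{\rm ITG}\|_{A}\leq\mathscr{U}_{3}$, where $\mathscr{L}_2$ is given by the same formula as in (ii) and $$\mathscr{L}_{3}=r_{1}-1-\min\Big\{r_{1}\lambda_{\min}^{+}(\widetilde{M}^{-1}A\Pi_{A})-\lambda_{\min}(\widetilde{M}^{-1}A),\ (r_{1}-1)\lambda_{\max}(\widetilde{M}^{-1}A)\Big\},$$ $$\mathscr{U}_{3}=\max\left\{1-\frac{1}{K_{\rm TG}},\ (r_{2}-1)\big(1-\lambda_{\min}^{+}(\widetilde{M}^{-1}A\Pi_{A})\big)\right\}.$$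
   Context: All matrices are real and $I$ is the identity matrix of appropriate size. $M^{-T}$ denotes $(M^{-1})^{T}$. For an SPD matrix $A$: $\|\mathbf{v}\|_{A}=\langle A\mathbf{v},\mathbf{v}\rangle^{1/2}$ for a vector $\mathbf{v}$, and $\|B\|_{A}=\max_{\mathbf{v}\neq 0}\|B\mathbf{v}\|_{A}/\|\mathbf{v}\|_{A}$ for a matrix $B$. $\lambda_{\min}(\cdot)$, $\lambda_{\min}^{+}(\cdot)$ and $\lambda_{\max}(\cdot)$ denote the smallest eigenvalue, the smallest positive eigenvalue and the largest eigenvalue of a matrix (all matrices to which these are applied have real spectrum). Definitions: $$\widetilde{M}:=M^{T}(M+M^{T}-A)^{-1}M,\qquad \Pi_{A}:=PA_{\rm c}^{-1}P^{T}A,\qquad \Pi_{\widetilde{M}}:=P(P^{T}\widetilde{M}P)^{-1}P^{T}\widetilde{M},$$ $$K_{\rm TG}:=\max_{\mathbf{v}\in\mathbb{R}^{n}\setminus\{0\}}\frac{\|(I-\Pi_{\widetilde{M}})\mathbf{v}\|_{\widetilde{M}}^{2}}{\|\mathbf{v}\|_{A}^{2}}.$$ The inexact two-grid method for $A\mathbf{u}=\mathbf{f}$ consists of presmoothing $\mathbf{u}^{(1)}=\mathbf{u}^{(0)}+M^{-1}(\mathbf{f}-A\mathbf{u}^{(0)})$, coarse-grid correction $\mathbf{u}^{(2)}=\mathbf{u}^{(1)}+PB_{\rm c}^{-1}P^{T}(\mathbf{f}-A\mathbf{u}^{(1)})$, and postsmoothing $\mathbf{u}_{\rm ITG}=\mathbf{u}^{(2)}+M^{-T}(\mathbf{f}-A\mathbf{u}^{(2)})$;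 its iteration matrix, i.e. the matrix with $\mathbf{u}-\mathbf{u}_{\rm ITG}=E_{\rm ITG}(\mathbf{u}-\mathbf{u}^{(0)})$, is the $E_{\rm ITG}$ given in the claim. *)

(* Defs.v *)
From HB Require Import structures.
From mathcomp Require Import all_boot all_order all_algebra.
From mathcomp Require Import all_classical all_reals.

Set Implicit Arguments.
Unset Strict Implicit.
Unset Printing Implicit Defensive.

Import Order.TTheory GRing.Theory Num.Theory.

Local Open Scope classical_set_scope.
Local Open Scope ring_scope.

Section Extrema.
Variable R : realType.

(* Greatest and least elements, required to belong to [S]; these are not
   [sup] and [inf].  The value is 0 when no such element exists. *)
Definition set_max (S : set R) : R := xget 0 (S `&` ubound S).
Definition set_min (S : set R) : R := xget 0 (S `&` lbound S).

End Extrema.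

Section Matrices.
Variables (R : realType) (n : nat).
Implicit Types (A B : 'M[R]_n) (v w : 'cV[R]_n).

Definition inner v w : R := (v^T *m w) 0 0.

Definition spd A : Prop :=
  A^T = A /\ forall v, v != 0 -> 0 < inner (A *m v) v.

Definition vnorm A v : R := Num.sqrt (inner (A *m v) v).

Definition mnorm A B : R :=
  set_max [set vnorm A (B *m v) / vnorm A v | v in [set v | v != 0]].

(* [eigenvalue] is stated with row eigenvectors; a square matrix over a field
   has the same eigenvalues on either side. *)
Definition lambda_min B : R := set_min [set l | eigenvalue B l].
Definition lambda_max B : R := set_max [set l | eigenvalue B l].
Definition lambda_min_pos B : R := set_min [set l | eigenvalue B l /\ 0 < l].

End Matrices.

Section TwoGrid.
Variables (R : realType) (n nc : nat).
Implicit Types (A M : 'M[R]_n) (P : 'M[R]_(n, nc)) (Bc : 'M[R]_nc).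

Definition coarse_mx A P : 'M[R]_nc := P^T *m A *m P.

Definition Mtilde A M : 'M[R]_n := M^T *m invmx (M + M^T - A) *m M.

Definition PiA A P : 'M[R]_n := P *m invmx (coarse_mx A P) *m P^T *m A.

Definition PiMtilde A M P : 'M[R]_n :=
  P *m invmx (P^T *m Mtilde A M *m P) *m P^T *m Mtilde A M.

Definition K_TG A M P : R :=
  set_max [set vnorm (Mtilde A M) ((1%:M - PiMtilde A M P) *m v) ^+ 2
               / vnorm A v ^+ 2 | v in [set v : 'cV[R]_n | v != 0]].

Definition E_ITG A M P Bc : 'M[R]_n :=
  (1%:M - (invmx M)^T *m A) *m (1%:M - P *m invmx Bc *m P^T *m A)
    *m (1%:M - invmx M *m A).

End TwoGrid.

(* Main.v *)
Require Import Defs.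
From mathcomp Require Import all_boot all_order all_algebra.
From mathcomp Require Import all_classical all_reals.
From mathcomp Require Import ring lra.
Import Order.TTheory GRing.Theory Num.Theory.
Local Open Scope ring_scope.

(** Write [S = I - M^-1 A] for the presmoother and [T = I - M^-T A] for the
    postsmoother, its adjoint for the energy product [<A v, w>].  The iteration
    matrix [E = T (I - P Bc^-1 P^T A) S] is self-adjoint for that product, and
    its energy form is
      [F v = <A E v, v> = <A S v, S v> - <Bc^-1 P^T A S v, P^T A S v>].
    Put [N v = <A v, v>], [G v = N (S v)] and
    [H v = <Ac^-1 P^T A S v, P^T A S v>], the energy of the coarse part
    [PiA S v] of [S v].  The extreme eigenvalues [r1], [r2] of [Bc^-1 Ac] are
    the best constants in [r1 Ac^-1 <= Bc^-1 <= r2 Ac^-1], so that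
      [G - r2 H <= F <= G - r1 H].

    Every quantity of the theorem is a best constant in an inequality between
    quadratic forms:
    - the energy norm of [E] is the least [t] with [|F| <= t N]
      ([mnorm_selfadjoint]);
    - [1 - lambda_min (Mt^-1 A)] is the least [d] with [G <= d N]
      ([presmoother_best]), and [1 - lambda_max (Mt^-1 A)] bounds [G / N] from
      below ([presmoother_lower]);
    - [1 - 1 / K_TG] is the least [a] with [G - H <= a N], i.e. the
      convergence factor of the exact two-grid method
      ([exact_two_grid_best]);
    - [1 - lambda_min_pos (Mt^-1 A PiA)] is the least [c] with [H <= c N]
      ([coarse_part_best]).
    Since [T^T A T = A - A Mt^-1 A], the spectral quantities speak of [T];
    they are carried over to [S] by the fact that a map and its adjoint have
    the same norm ([adjoint_bound]).

    With these in hand all estimates follow by combining inequalities.  For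
    instance [G - r1 H = r1 (G - H) + (1 - r1) G <= (r1 a + (1 - r1) d) N]
    gives the first upper bound, and
    [r2 (G - H) = (G - r2 H) + (r2 - 1) G <= (t + (r2 - 1) d) N] together with
    the minimality of [a] gives [r2 a - (r2 - 1) d <= t].  The two bounds that
    involve [lambda_max] evaluate [F] at a vector with [H v = 0], respectively
    [H v = G v]; both exist because [nc] lies strictly between 0 and [n].

    Attainment of the extrema is needed because the maxima and minima in the
    definitions are taken only when they exist.  It comes from [rayleigh_max],
    whose proof needs only suprema of real sets and the Cauchy-Schwarz
    inequality. *)

(** * Quadratic forms *)

Section Forms.
Set Implicit Arguments.
Unset Strict Implicit.
Unset Printing Implicit Defensive.
Variable R : realType.

Definition quad n (B : 'M[R]_n) (v : 'cV[R]_n) : R := inner (B *m v) v.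

Definition psd n (B : 'M[R]_n) : Prop := B^T = B /\ forall v, 0 <= quad B v.

Lemma innerC n (v w : 'cV[R]_n) : inner v w = inner w v.
Proof.
by rewrite /inner -[in LHS](trmxK (v^T *m w)) mxE trmx_mul trmxK.
Qed.

Lemma inner_mull m n (C : 'M[R]_(m, n)) v w :
  inner (C *m v) w = inner v (C^T *m w).
Proof. by rewrite /inner trmx_mul mulmxA. Qed.

Lemma innerDl n (u v w : 'cV[R]_n) : inner (u + v) w = inner u w + inner v w.
Proof. by rewrite /inner linearD mulmxDl mxE. Qed.

Lemma innerZl n a (v w : 'cV[R]_n) : inner (a *: v) w = a * inner v w.
Proof. by rewrite /inner linearZ -scalemxAl mxE. Qed.

Lemma innerNl n (v w : 'cV[R]_n) : inner (- v) w = - inner v w.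
Proof. by rewrite -scaleN1r innerZl mulN1r. Qed.

Lemma innerDr n (u v w : 'cV[R]_n) : inner u (v + w) = inner u v + inner u w.
Proof. by rewrite innerC innerDl !(innerC u). Qed.

Lemma innerZr n a (v w : 'cV[R]_n) : inner v (a *: w) = a * inner v w.
Proof. by rewrite innerC innerZl innerC. Qed.

Lemma inner0r n (v : 'cV[R]_n) : inner v 0 = 0.
Proof. by rewrite /inner mulmx0 mxE. Qed.

Lemma inner_gt0 n (v : 'cV[R]_n) : v != 0 -> 0 < inner v v.
Proof.
move=> v0; have sq i : v^T 0 i * v i 0 = v i 0 ^+ 2 by rewrite mxE expr2.
rewrite /inner mxE (eq_bigr _ (fun i _ => sq i)).
rewrite lt0r sumr_ge0 ?andbT; last by move=> i _; exact: sqr_ge0.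
rewrite psumr_eq0; last by move=> i _; exact: sqr_ge0.
apply: contraNN v0 => /allP vi0; apply/eqP/colP=> i; rewrite mxE.
by apply/eqP; rewrite -sqrf_eq0; apply: vi0; rewrite mem_index_enum.
Qed.

Lemma quadD n (B C : 'M[R]_n) v : quad (B + C) v = quad B v + quad C v.
Proof. by rewrite /quad mulmxDl innerDl. Qed.

Lemma quadZ n a (B : 'M[R]_n) v : quad (a *: B) v = a * quad B v.
Proof. by rewrite /quad -scalemxAl innerZl. Qed.

Lemma quadN n (B : 'M[R]_n) v : quad (- B) v = - quad B v.
Proof. by rewrite /quad mulNmx innerNl. Qed.

Lemma quadB n (B C : 'M[R]_n) v : quad (B - C) v = quad B v - quad C v.
Proof. by rewrite quadD quadN. Qed.

Lemma quad0 n (B : 'M[R]_n) : quad B 0 = 0.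
Proof. by rewrite /quad inner0r. Qed.

Lemma quad_congr m n (C : 'M[R]_(m, n)) (B : 'M[R]_m) v :
  quad (C^T *m B *m C) v = quad B (C *m v).
Proof. by rewrite /quad -!mulmxA inner_mull trmxK. Qed.

Lemma quad_scale n (B : 'M[R]_n) a v : quad B (a *: v) = a ^+ 2 * quad B v.
Proof. by rewrite /quad -scalemxAr innerZl innerZr; ring. Qed.

Lemma inner_sym n (B : 'M[R]_n) v w :
  B^T = B -> inner (B *m v) w = inner (B *m w) v.
Proof. by move=> Bs; rewrite inner_mull Bs innerC. Qed.

Lemma quad_add n (B : 'M[R]_n) v w : B^T = B ->
  quad B (v + w) = quad B v + 2 * inner (B *m v) w + quad B w.
Proof.
move=> Bs; rewrite /quad mulmxDr !(innerDl, innerDr) (inner_sym w v Bs).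
by ring.
Qed.

Lemma spd_psd n (Q : 'M[R]_n) : spd Q -> psd Q.
Proof.
move=> [Qs Qp]; split=> // v; have [->|v0] := eqVneq v 0.
  by rewrite quad0.
exact/ltW/Qp.
Qed.

Lemma cauchy_schwarz n (D : 'M[R]_n) v w : psd D ->
  inner (D *m v) w ^+ 2 <= quad D v * quad D w.
Proof.
move=> [Ds Dp]; set b := inner _ _.
have comb x y : 0 <= x ^+ 2 * quad D v + 2 * (x * y * b) + y ^+ 2 * quad D w.
  have := Dp (x *: v + y *: w).
  by rewrite quad_add // !quad_scale -scalemxAr innerZl innerZr -/b !mulrA.
have := comb (quad D w) (- b); have := comb (- b) (quad D v).
have := comb 1 (- b).
have := Dp v; have := Dp w; move: (quad D v) (quad D w) => a c c0 a0 h1 h2 h3.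
have [a_gt0|a_le0] := ltP 0 a; last first.
  have [c_gt0|c_le0] := ltP 0 c; last first.
    have az : a = 0 by lra.
    have cz : c = 0 by lra.
    by move: h1 h2 h3; rewrite az cz; lra.
  have : 0 <= c * (a * c - b ^+ 2) by lra.
  by rewrite pmulr_rge0 // subr_ge0.
have : 0 <= a * (a * c - b ^+ 2) by lra.
by rewrite pmulr_rge0 // subr_ge0.
Qed.

Lemma psd_kernel n (D : 'M[R]_n) v : psd D -> quad D v = 0 -> D *m v = 0.
Proof.
move=> Dp Dv; apply/eqP; apply/negPn/negP => /inner_gt0 h.
have := cauchy_schwarz v (D *m v) Dp; rewrite Dv mul0r.
by apply/negP; rewrite -ltNge exprn_gt0.
Qed.

Lemma singularP m n (C : 'M[R]_(m, n)) :
  (exists2 v : 'cV[R]_n, v != 0 & C *m v = 0) <-> (\rank C < n)%N.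
Proof.
rewrite -mxrank_tr; split=> [[v v0 Cv]|].
  rewrite ltn_neqAle rank_leq_row andbT; apply: contraNN v0 => /eqP full.
  have /row_free_inj inj : row_free C^T by apply/eqP.
  apply/eqP/trmx_inj; rewrite trmx0; apply: inj.
  by rewrite -trmx_mul Cv trmx0 mul0mx.
rewrite -subn_gt0 -mxrank_ker lt0n mxrank_eq0 => /rowV0Pn[u uk u0].
exists u^T; first by rewrite -trmx0 (inj_eq trmx_inj).
by apply: trmx_inj; rewrite trmx_mul trmxK (sub_kermxP uk) trmx0.
Qed.

Lemma unitmx_ker0 n (C : 'M[R]_n) :
  (forall v : 'cV[R]_n, C *m v = 0 -> v = 0) -> C \in unitmx.
Proof.
move=> C0; rewrite -row_full_unit /row_full eqn_leq rank_leq_col leqNgt.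
apply/negP=> /(singularP C)[v v0 Cv]; case/eqP: v0; exact: C0.
Qed.

Lemma spd_unit n (Q : 'M[R]_n) : spd Q -> Q \in unitmx.
Proof.
move=> [_ Qp]; apply: unitmx_ker0 => v Qv; apply/eqP; apply/negPn/negP.
by move=> /Qp; rewrite Qv innerC inner0r ltxx.
Qed.

Lemma psd_unit_spd n (D : 'M[R]_n) : psd D -> D \in unitmx -> spd D.
Proof.
move=> Dp Du; split=> [|v v0]; first exact: Dp.1.
rewrite lt0r (Dp.2 v) andbT; apply: contraNN v0 => /eqP /(psd_kernel Dp) Dv.
by rewrite -(mulKmx Du v) Dv mulmx0.
Qed.

Lemma sym_congr m n (C : 'M[R]_(m, n)) (B : 'M[R]_m) :
  B^T = B -> (C^T *m B *m C)^T = C^T *m B *m C.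
Proof. by move=> Bs; rewrite !trmx_mul trmxK Bs mulmxA. Qed.

Lemma spd_congr m n (C : 'M[R]_(m, n)) (Q : 'M[R]_m) :
  (forall v : 'cV[R]_n, C *m v = 0 -> v = 0) -> spd Q -> spd (C^T *m Q *m C).
Proof.
move=> C0 [Qs Qp]; split=> [|v v0]; first exact: sym_congr.
rewrite -/(quad _ v) quad_congr; apply: Qp.
by apply: contraNN v0 => /eqP/C0 ->.
Qed.

Lemma spd_inv n (Q : 'M[R]_n) : spd Q -> spd (invmx Q).
Proof.
move=> hQ; have Qu := spd_unit hQ; have [Qs _] := hQ.
have iQs : (invmx Q)^T = invmx Q by rewrite trmx_inv Qs.
have -> : invmx Q = (invmx Q)^T *m Q *m invmx Q by rewrite iQs mulVmx ?mul1mx.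
by apply: spd_congr => // v iQv; rewrite -(mulKVmx Qu v) iQv mulmx0.
Qed.

Lemma quad_inv n (Q : 'M[R]_n) y : spd Q ->
  quad Q (invmx Q *m y) = quad (invmx Q) y.
Proof.
move=> hQ; rewrite -quad_congr trmx_inv hQ.1 mulVmx ?mul1mx //.
exact: spd_unit.
Qed.

Lemma quad_inv_mul n (Q : 'M[R]_n) u : spd Q ->
  quad (invmx Q) (Q *m u) = quad Q u.
Proof. by move=> hQ; rewrite -quad_inv // mulKmx // spd_unit. Qed.

(** A coordinate of [v] is [<D v, D^-1 e_i>], so Cauchy-Schwarz bounds it by
    the energy of [v]; a quadratic form is a finite sum of products of
    coordinates. *)
Lemma spd_dominates n (D B : 'M[R]_n) : spd D ->
  exists2 c, 0 < c & forall v, quad B v <= c * quad D v.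
Proof.
move=> hD; have Du := spd_unit hD; have hp := spd_psd hD.
pose e (i : 'I_n) : 'cV[R]_n := invmx D *m delta_mx i 0.
pose k := \sum_i quad D (e i).
have k0 i : 0 <= quad D (e i) by exact: hp.2.
have coord (v : 'cV[R]_n) i : v i 0 ^+ 2 <= k * quad D v.
  have -> : v i 0 = inner (D *m v) (e i).
    rewrite innerC inner_mull trmx_inv hD.1 mulKmx //.
    by rewrite /inner trmx_delta -rowE mxE.
  apply: le_trans (cauchy_schwarz _ _ hp) _; rewrite mulrC ler_wpM2r ?hp.2 //.
  by rewrite /k (bigD1 i) //= lerDl sumr_ge0.
pose c := \sum_i \sum_j `|B i j|.
have c0 : 0 <= c by apply: sumr_ge0 => i _; apply: sumr_ge0.
exists (c * k + 1); first by rewrite ltr_wpDl // mulr_ge0 // sumr_ge0.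
move=> v; apply: (@le_trans _ _ (c * (k * quad D v))); last first.
  by have := hp.2 v; lra.
have := coord v; move: (k * quad D v) => q hq.
rewrite /c mulr_suml /quad innerC /inner mxE ler_sum // => i _.
rewrite mulr_suml [(B *m v) i 0]mxE mulr_sumr ler_sum // => j _.
rewrite mxE; apply: le_trans (ler_norm _) _.
rewrite mulrCA normrM ler_wpM2l // ler_norml.
have := hq i; have := hq j.
have := sqr_ge0 (v i 0 - v j 0); have := sqr_ge0 (v i 0 + v j 0).
by rewrite sqrrD sqrrB => *; apply/andP; split; lra.
Qed.

Lemma delta_neq0 n (n0 : (0 < n)%N) : delta_mx (Ordinal n0) 0 != 0 :> 'cV[R]_n.
Proof.
by apply/eqP => /matrixP/(_ (Ordinal n0) 0)/eqP; rewrite !mxE !eqxx oner_eq0.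
Qed.

(** Let [t] be the supremum of the Rayleigh quotient; then [D = t Q - B] is
    positive semidefinite.  Were it invertible it would dominate a multiple of
    [Q], and [t] could be lowered; so it has a kernel vector, which is an
    eigenvector of the pencil [(B, Q)] for [t]. *)
Lemma rayleigh_max n (B Q : 'M[R]_n) : (0 < n)%N -> B^T = B -> spd Q ->
  exists t, (forall v, quad B v <= t * quad Q v) /\
    exists2 v : 'cV[R]_n, v != 0 & B *m v = t *: (Q *m v).
Proof.
move=> n0 Bs hQ.
pose S := [set t | exists2 v : 'cV[R]_n,
                     v != 0 & t = quad B v / quad Q v]%classic.
have [c c0 hc] := spd_dominates B hQ.
have ubS : has_ubound S.
  by exists c => _ [v v0 ->]; rewrite ler_pdivrMr; [exact: hc | exact: hQ.2].
have le_sup v : quad B v <= sup S * quad Q v.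
  have [->|v0] := eqVneq v 0; first by rewrite !quad0 mulr0.
  rewrite -ler_pdivrMr; last exact: hQ.2.
  by apply: ub_le_sup => //; exists v.
exists (sup S); split=> //.
pose D := sup S *: Q - B.
have quadE v : quad D v = sup S * quad Q v - quad B v by rewrite quadB quadZ.
have Dp : psd D.
  split=> [|v]; first by rewrite /D linearB linearZ /= Bs hQ.1.
  by rewrite quadE subr_ge0.
suff /negP Dn : D \notin unitmx.
  have /singularP[v v0 Dv] : (\rank D < n)%N.
    rewrite ltn_neqAle rank_leq_col andbT; apply/negP.
    by rewrite -row_full_unit in Dn.
  exists v => //; apply/esym/eqP; rewrite -subr_eq0; apply/eqP.
  by rewrite -Dv mulmxBl scalemxAl.
apply/negP=> Du; have [k k0 hk] := spd_dominates Q (psd_unit_spd Dp Du).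
have le_t : sup S <= sup S - k^-1.
  apply: ge_sup.
    pose v : 'cV[R]_n := delta_mx (Ordinal n0) 0.
    exists (quad B v / quad Q v), v => //.
    exact: delta_neq0.
  move=> _ [v v0 ->]; rewrite ler_pdivrMr; last exact: hQ.2.
  have := hk v; rewrite quadE -(ler_pdivrMl _ _ k0) mulrBl; lra.
have : 0 < k^-1 by rewrite invr_gt0.
by move: le_t; rewrite lerDl oppr_ge0 leNgt => /negP.
Qed.

End Forms.

(** * Best constants and extreme eigenvalues *)

Section BestConstants.
Set Implicit Arguments.
Unset Strict Implicit.
Unset Printing Implicit Defensive.
Variable R : realType.

Definition best_upper (T : Type) (F G : T -> R) (c : R) : Prop :=
  (forall x, F x <= c * G x) /\ forall s, (forall x, F x <= s * G x) -> c <= s.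

Definition best_lower (T : Type) (F G : T -> R) (c : R) : Prop :=
  (forall x, c * G x <= F x) /\ forall s, (forall x, s * G x <= F x) -> s <= c.

Lemma set_maxE (S : set R) t : S t -> ubound S t -> set_max S = t.
Proof.
move=> St ubt; rewrite /set_max; case: xgetP => [x -> [Sx ubx]|/(_ t)[]//].
by apply/le_anti; rewrite ubt // ubx.
Qed.

Lemma set_minE (S : set R) t : S t -> lbound S t -> set_min S = t.
Proof.
move=> St lbt; rewrite /set_min; case: xgetP => [x -> [Sx lbx]|/(_ t)[]//].
by apply/le_anti; rewrite lbt // lbx.
Qed.

Lemma best_upper_attained n (F : 'cV[R]_n -> R) (Q : 'M[R]_n) t : spd Q ->
  (forall v, F v <= t * quad Q v) -> (exists2 v, v != 0 & F v = t * quad Q v) ->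
  best_upper F (quad Q) t.
Proof.
move=> hQ ub [v v0 Fv]; split=> // s /(_ v); rewrite Fv ler_pM2r //.
exact: hQ.2.
Qed.

Lemma best_upper_rayleigh n (B Q : 'M[R]_n) : (0 < n)%N -> B^T = B -> spd Q ->
  exists t, best_upper (quad B) (quad Q) t /\
    exists2 v : 'cV[R]_n, v != 0 & B *m v = t *: (Q *m v).
Proof.
move=> n0 Bs hQ; have [t [ub [v v0 Bv]]] := rayleigh_max n0 Bs hQ.
exists t; split; last by exists v.
by apply: best_upper_attained => //; exists v; rewrite // /quad Bv innerZl.
Qed.

Lemma best_lower_rayleigh n (B Q : 'M[R]_n) : (0 < n)%N -> B^T = B -> spd Q ->
  exists t, best_lower (quad B) (quad Q) t /\
    exists2 v : 'cV[R]_n, v != 0 & B *m v = t *: (Q *m v).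
Proof.
move=> n0 Bs hQ.
have [|t [[ub lst] [v v0 Bv]]] := @best_upper_rayleigh _ (- B) Q n0 _ hQ.
  by rewrite linearN /= Bs.
exists (- t); split; last by exists v; rewrite // scaleNr -Bv mulNmx opprK.
split=> [w|s hs]; first by have := ub w; rewrite quadN; lra.
by rewrite lerNr; apply: lst => w; rewrite quadN mulNr lerN2.
Qed.

(** A row eigenvector [u] of [B Q^-1] is turned into the column [u^T]: for
    symmetric [B] and [Q], [u B Q^-1 = l u] reads [B u^T = l Q u^T]. *)
Lemma eigenvalue_pencil n (B Q : 'M[R]_n) l : B^T = B -> spd Q ->
  eigenvalue (B *m invmx Q) l <->
  exists2 v : 'cV[R]_n, v != 0 & B *m v = l *: (Q *m v).
Proof.
move=> Bs hQ; have Qu := spd_unit hQ; have Qs := hQ.1.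
split=> [/eigenvalueP[u uB u0]|[v v0 Bv]].
  exists u^T; first by rewrite -trmx0 (inj_eq trmx_inj).
  apply: trmx_inj; rewrite linearZ /= !trmx_mul !trmxK Bs Qs.
  by rewrite scalemxAl -uB -!mulmxA mulVmx // mulmx1.
apply/eigenvalueP; exists v^T; last by rewrite -trmx0 (inj_eq trmx_inj).
rewrite mulmxA -{1}Bs -trmx_mul Bv linearZ /= trmx_mul Qs.
by rewrite -scalemxAl mulmxK.
Qed.

Lemma eigen_rayleigh n (B Q : 'M[R]_n) l (v : 'cV[R]_n) :
  B *m v = l *: (Q *m v) -> quad B v = l * quad Q v.
Proof. by move=> Bv; rewrite /quad Bv innerZl. Qed.

Lemma lambda_max_best n (B Q : 'M[R]_n) : (0 < n)%N -> B^T = B -> spd Q ->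
  best_upper (quad B) (quad Q) (lambda_max (B *m invmx Q)).
Proof.
move=> n0 Bs hQ; have [t [tb tv]] := best_upper_rayleigh n0 Bs hQ.
suff -> : lambda_max (B *m invmx Q) = t by [].
apply: set_maxE => [|l /= /eigenvalue_pencil[]// v v0 Bv].
  exact/eigenvalue_pencil.
have := tb.1 v; rewrite (eigen_rayleigh Bv) ler_pM2r //; exact: hQ.2.
Qed.

(** Stated for any description [S] of the spectrum, since the smallest positive
    eigenvalue of a singular product will be obtained from the spectrum of a
    smaller pencil. *)
Lemma min_eigen_best n (B Q : 'M[R]_n) S : (0 < n)%N -> B^T = B -> spd Q ->
  (forall l, S l <-> eigenvalue (B *m invmx Q) l) ->
  best_lower (quad B) (quad Q) (set_min S).
Proof.
move=> n0 Bs hQ eS; have [t [tb tv]] := best_lower_rayleigh n0 Bs hQ.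
suff -> : set_min S = t by [].
apply: set_minE => [|l /eS /eigenvalue_pencil[]// v v0 Bv].
  exact/eS/eigenvalue_pencil.
have := tb.1 v; rewrite (eigen_rayleigh Bv) ler_pM2r //; exact: hQ.2.
Qed.

Lemma lambda_min_best n (B Q : 'M[R]_n) : (0 < n)%N -> B^T = B -> spd Q ->
  best_lower (quad B) (quad Q) (lambda_min (B *m invmx Q)).
Proof. by move=> n0 Bs hQ; apply: min_eigen_best. Qed.

Lemma bound_ge0 n (F : 'cV[R]_n -> R) Q s : (0 < n)%N -> spd Q ->
  (forall v, 0 <= F v) -> (forall v, F v <= s * quad Q v) -> 0 <= s.
Proof.
move=> n0 hQ F0 hs; have := le_trans (F0 _) (hs (delta_mx (Ordinal n0) 0)).
by rewrite pmulr_lge0 //; apply/hQ.2/delta_neq0.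
Qed.

(** [C] and [C'] are adjoint to each other for the products of [Q1] and [Q2],
    and a map and its adjoint have the same norm: with [N = |C' v|^2 =
    <C C' v, v>], Cauchy-Schwarz gives [N^2 <= |C C' v|^2 |v|^2 <=
    s N |v|^2]. *)
Lemma adjoint_bound m n (Q1 : 'M[R]_m) (Q2 : 'M[R]_n) C C' s :
  psd Q1 -> psd Q2 -> 0 <= s -> C^T *m Q2 = Q1 *m C' ->
  (forall w, quad Q2 (C *m w) <= s * quad Q1 w) ->
  forall v, quad Q1 (C' *m v) <= s * quad Q2 v.
Proof.
move=> h1 h2 s0 adj hC v; set N := quad Q1 _.
have NE : N = inner (Q2 *m (C *m (C' *m v))) v.
  rewrite /N /quad (mulmxA Q1) -adj -mulmxA inner_mull trmxK.
  exact: inner_sym h2.1.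
have N0 : 0 <= N by exact: h1.2.
have := cauchy_schwarz (C *m (C' *m v)) v h2; rewrite -NE.
have := hC (C' *m v); rewrite -/N => hN hcs.
have q0 := h2.2 v.
have : N * N <= N * (s * quad Q2 v).
  by rewrite -expr2; apply: le_trans hcs _; rewrite mulrCA mulrA ler_wpM2r.
have [N_gt0|Nle0 _] := ltP 0 N; first by rewrite ler_pM2l.
exact: le_trans Nle0 (mulr_ge0 s0 q0).
Qed.

Lemma adjoint_best m n (Q1 : 'M[R]_m) (Q2 : 'M[R]_n) C C' s :
  (0 < m)%N -> (0 < n)%N -> spd Q1 -> spd Q2 -> C^T *m Q2 = Q1 *m C' ->
  best_upper (fun w => quad Q2 (C *m w)) (quad Q1) s ->
  best_upper (fun v => quad Q1 (C' *m v)) (quad Q2) s.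
Proof.
move=> m0 n0 h1 h2 adj [ub lst].
have p1 := spd_psd h1; have p2 := spd_psd h2.
split=> [v|t ht].
  apply: (adjoint_bound p1 p2 _ adj ub).
  by apply: (bound_ge0 m0 h1 _ ub) => w; exact: p2.2.
apply: lst; apply: (adjoint_bound p2 p1 _ _ ht).
  by apply: (bound_ge0 n0 h2 _ ht) => w; exact: p1.2.
by rewrite -[Q1]h1.1 -trmx_mul -adj trmx_mul trmxK h2.1.
Qed.

End BestConstants.

(** * The energy norm of a self-adjoint matrix *)

Section EnergyNorm.
Set Implicit Arguments.
Unset Strict Implicit.
Unset Printing Implicit Defensive.
Variable R : realType.

(** For a self-adjoint map the form controls the norm, by polarisation at
    [v + k E v] and [v - k E v]. *)
Lemma selfadjoint_norm_le n (A E : 'M[R]_n) s : psd A -> (A *m E)^T = A *m E ->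
  0 <= s -> (forall v, `|quad (A *m E) v| <= s * quad A v) ->
  forall v, quad A (E *m v) <= s ^+ 2 * quad A v.
Proof.
move=> hA AEs s0 hs v; set w := E *m v.
have N0 := hA.2 w; have V0 := hA.2 v.
have pol k : 2 * (k * quad A w) <= s * (quad A v + k ^+ 2 * quad A w).
  have := hs (v + k *: w); have := hs (v + (- k) *: w).
  rewrite !quad_add ?hA.1 // !quad_scale !innerZr.
  have -> : inner (A *m E *m v) w = quad A w by rewrite -mulmxA.
  rewrite !ler_norml => /andP[h1 h2] /andP[h3 h4].
  by have := lerD h1 h4; rewrite sqrrN; lra.
have [s_gt0|s_le0] := ltP 0 s; last first.
  have sE : s = 0 by lra.
  by have := pol 1; rewrite sE; lra.
(* [k = 1 / s] minimises the resulting bound on the energy of [w]. *)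
have := pol s^-1; rewrite -(ler_pM2l s_gt0).
have -> : s * (2 * (s^-1 * quad A w)) = 2 * quad A w.
  by field; rewrite gt_eqF.
have -> : s * (s * (quad A v + s^-1 ^+ 2 * quad A w)) =
    s ^+ 2 * quad A v + quad A w.
  by field; rewrite gt_eqF.
lra.
Qed.

Lemma mnorm_selfadjoint n (A E : 'M[R]_n) : (0 < n)%N -> spd A ->
  (A *m E)^T = A *m E ->
  best_upper (fun v => `|quad (A *m E) v|) (quad A) (mnorm A E).
Proof.
move=> n0 hA AEs; have pA := spd_psd hA.
have symE : (E^T *m A *m E)^T = E^T *m A *m E by exact/sym_congr/hA.1.
have [T [Tb [v0 v00 Tv]]] := best_upper_rayleigh n0 symE hA.
have quadE v : quad (E^T *m A *m E) v = quad A (E *m v) by exact: quad_congr.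
have T0 : 0 <= T.
  by apply: (bound_ge0 n0 hA _ Tb.1) => v; rewrite quadE; exact: pA.2.
have Ev v : quad A (E *m v) <= T * quad A v by rewrite -quadE; exact: Tb.1.
have -> : mnorm A E = Num.sqrt T.
  apply: set_maxE => [|_ [v /= vn0 <-]].
    exists v0 => //; rewrite /vnorm -/(quad _ _) -quadE (eigen_rayleigh Tv).
    by rewrite sqrtrM // mulfK // sqrtr_eq0 -ltNge; exact: hA.2.
  have Av : 0 < Num.sqrt (quad A v) by rewrite sqrtr_gt0; exact: hA.2.
  by rewrite ler_pdivrMr // -sqrtrM // ler_wsqrtr //; exact: Ev.
split=> [v|s hs].
  rewrite -sqrtr_sqr -[quad A v]ger0_norm ?pA.2 // -sqrtr_sqr -sqrtrM //.
  rewrite ler_wsqrtr // {1}/quad -mulmxA.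
  apply: le_trans (cauchy_schwarz _ _ pA) _.
  rewrite expr2 mulrA ler_wpM2r ?pA.2 //; exact: Ev.
have s0 : 0 <= s by apply: (bound_ge0 n0 hA _ hs) => v; exact: normr_ge0.
rewrite -[s]ger0_norm // -sqrtr_sqr ler_wsqrtr //; apply: Tb.2 => v.
by rewrite quadE; exact: selfadjoint_norm_le.
Qed.

End EnergyNorm.

(** * The projection along the coarse space *)

Section Projection.
Set Implicit Arguments.
Unset Strict Implicit.
Unset Printing Implicit Defensive.
Variables (R : realType) (n nc : nat) (Q : 'M[R]_n) (P : 'M[R]_(n, nc)).
Hypotheses (hQ : spd Q) (hP : \rank P = nc).

Lemma full_rank_inj (w : 'cV[R]_nc) : P *m w = 0 -> w = 0.
Proof.
move=> Pw; apply/eqP; apply/negPn/negP => w0.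
have /singularP : exists2 w : 'cV[R]_nc, w != 0 & P *m w = 0 by exists w.
by rewrite hP ltnn.
Qed.

Lemma coarse_spd : spd (coarse_mx Q P).
Proof. exact: spd_congr full_rank_inj hQ. Qed.

Lemma quad_coarse w : quad (coarse_mx Q P) w = quad Q (P *m w).
Proof. exact: quad_congr. Qed.

Let Cu : coarse_mx Q P \in unitmx := spd_unit coarse_spd.

Definition coarse_compl := 1%:M - PiA Q P.

Lemma coarse_compl_sym : coarse_compl^T *m Q = Q *m coarse_compl.
Proof.
rewrite /coarse_compl linearB /= trmx1 mulmxBl mulmxBr mul1mx mulmx1.
by rewrite /PiA !trmx_mul trmxK trmx_inv (coarse_spd).1 hQ.1 !mulmxA.
Qed.

Lemma coarse_compl_coarse : coarse_compl *m P = 0.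
Proof.
rewrite /coarse_compl mulmxBl mul1mx /PiA -!mulmxA (mulmxA P^T).
by rewrite -/(coarse_mx Q P) mulVmx // mulmx1 subrr.
Qed.

Lemma coarse_compl_range : P^T *m Q *m coarse_compl = 0.
Proof.
rewrite /coarse_compl mulmxBr mulmx1 /PiA !mulmxA -/(coarse_mx Q P).
by rewrite mulmxV // mul1mx subrr.
Qed.

Lemma coarse_compl_id (v : 'cV[R]_n) :
  P^T *m Q *m v = 0 -> coarse_compl *m v = v.
Proof.
move=> Pv; rewrite /coarse_compl mulmxBl mul1mx /PiA.
by rewrite -!mulmxA (mulmxA P^T) Pv !mulmx0 subr0.
Qed.

(** Pythagoras for the splitting of [v] into [PiA Q P *m v] and its
    complement. *)
Lemma quad_coarse_compl v : quad Q (coarse_compl *m v) =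
  quad Q v - quad (coarse_mx Q P) (invmx (coarse_mx Q P) *m (P^T *m (Q *m v))).
Proof.
set w := invmx _ *m _.
have cv : coarse_compl *m v = v - P *m w.
  by rewrite /coarse_compl mulmxBl mul1mx /w /PiA !mulmxA.
have orth : P^T *m (Q *m (coarse_compl *m v)) = 0.
  by rewrite !mulmxA coarse_compl_range mul0mx.
have -> : quad Q v = quad Q (coarse_compl *m v + P *m w) by rewrite cv subrK.
rewrite quad_add ?hQ.1 // quad_coarse innerC inner_mull orth inner0r.
by ring.
Qed.

Lemma quad_coarse_compl_le v : quad Q (coarse_compl *m v) <= quad Q v.
Proof. by rewrite quad_coarse_compl gerBl; case: (spd_psd coarse_spd). Qed.

End Projection.

(** * The constants of the two-grid method *)

Section TwoGrid.
Set Implicit Arguments.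
Unset Strict Implicit.
Unset Printing Implicit Defensive.
Variables (R : realType) (n nc : nat) (A M : 'M[R]_n) (P : 'M[R]_(n, nc)).
Hypotheses (hA : spd A) (hM : M \in unitmx) (hMA : spd (M + M^T - A)).
Hypotheses (hnc0 : (0 < nc)%N) (hnc : (nc < n)%N) (hP : \rank P = nc).

Let n0 : (0 < n)%N := ltn_trans hnc0 hnc.
Let pA : psd A := spd_psd hA.
Let Au : A \in unitmx := spd_unit hA.
Let Wu : M + M^T - A \in unitmx := spd_unit hMA.
Let Ac := coarse_mx A P.
Let hAc : spd Ac := coarse_spd hA hP.
Let Acu : Ac \in unitmx := spd_unit hAc.
Let Mt := Mtilde A M.
Let S : 'M[R]_n := 1%:M - invmx M *m A.
Let T : 'M[R]_n := 1%:M - (invmx M)^T *m A.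
Let Z := coarse_compl A P.

Lemma coarse_ker : exists2 v : 'cV[R]_n, v != 0 & P^T *m A *m v = 0.
Proof. by apply/singularP; apply: leq_ltn_trans (rank_leq_row _) hnc. Qed.

(** The constant of [K_TG] seen from the dual side.  The adjoint of the
    projection [Z'] maps [w] to [u = A^-1 Q Z' w]; these are the vectors with
    [P^T A u = 0], and [w = Q^-1 A u], whose energy is [<Q^-1 A u, A u>], is
    the cheapest preimage of [u]. *)
Lemma coarse_compl_dual (Q : 'M[R]_n) k : spd Q ->
  (forall v, quad Q (coarse_compl Q P *m v) <= k * quad A v) <->
  (forall u, P^T *m A *m u = 0 -> quad A u <= k * quad (invmx Q) (A *m u)).
Proof.
move=> hQ; have Qu := spd_unit hQ; set Z' := coarse_compl Q P.
have pQ := spd_psd hQ.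
have iQ := spd_psd (spd_inv hQ).
have ZQ : Z'^T *m Q = Q *m Z' by exact: coarse_compl_sym.
have adj : Z'^T *m Q = A *m (invmx A *m (Q *m Z')) by rewrite mulKVmx.
have [u1 u10 Pu1] := coarse_ker.
split=> [hk u Pu|hk].
  have k0 : 0 <= k by apply: (bound_ge0 n0 hA _ hk) => v; exact: pQ.2.
  have := adjoint_bound pA pQ k0 adj hk (invmx Q *m (A *m u)).
  have -> : invmx A *m (Q *m Z') *m (invmx Q *m (A *m u)) = u.
    rewrite -!mulmxA [Z' *m _]coarse_compl_id //.
      by rewrite mulKVmx // mulKmx.
    by rewrite -mulmxA mulKVmx // mulmxA.
  by rewrite quad_inv.
have k0 : 0 <= k.
  have := le_trans (ltW (hA.2 _ u10)) (hk _ Pu1).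
  rewrite pmulr_lge0 //; apply: (spd_inv hQ).2.
  by apply: contraNN u10 => /eqP Au1; rewrite -(mulKmx Au u1) Au1 mulmx0.
apply: (adjoint_bound pQ pA k0 (C := invmx A *m (Q *m Z'))).
  rewrite trmx_mul (trmx_mul Q Z') trmx_inv hA.1 hQ.1 ZQ.
  by rewrite -!mulmxA mulVmx // mulmx1.
move=> w; set u := invmx A *m _ *m w.
have Auw : A *m u = Q *m (Z' *m w) by rewrite /u -!mulmxA mulKVmx.
apply: le_trans (hk u _) _.
  by rewrite -mulmxA Auw !mulmxA coarse_compl_range // mul0mx.
rewrite Auw quad_inv_mul // ler_wpM2l //.
exact: quad_coarse_compl_le.
Qed.

Lemma Mtilde_spd : spd (Mtilde A M).
Proof.
apply: spd_congr (spd_inv hMA) => v Mv.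
by rewrite -(mulKmx hM v) Mv mulmx0.
Qed.

Let hMt : spd Mt := Mtilde_spd.
Let Mtu : Mt \in unitmx := spd_unit hMt.

Lemma invmx_Mtilde :
  invmx (Mtilde A M) = invmx M *m (M + M^T - A) *m (invmx M)^T.
Proof.
rewrite -[RHS](mulKmx Mtu) -[LHS]mulmx1; congr (_ *m _).
rewrite /Mt /Mtilde -!mulmxA mulKVmx // mulKmx // trmx_inv mulmxV //.
by rewrite unitmx_tr.
Qed.

Lemma smoother_adj : T^T *m A = A *m S.
Proof.
rewrite /T /S linearB /= trmx1 trmx_mul trmxK hA.1.
by rewrite mulmxBl mulmxBr mul1mx mulmx1 mulmxA.
Qed.

(** The postsmoother satisfies [T^T A T = A - A Mt^-1 A], which is how the
    spectrum of [Mt^-1 A] enters. *)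
Lemma quad_post u : quad A (T *m u) = quad A u - quad (invmx Mt) (A *m u).
Proof.
have As := hA.1; have MTu : M^T \in unitmx by rewrite unitmx_tr.
pose Mi := invmx M.
have e : invmx Mt = Mi^T + Mi - Mi *m A *m Mi^T.
  rewrite invmx_Mtilde mulmxBr mulmxDr mulmxBl mulmxDl mulVmx // mul1mx.
  by rewrite -[Mi *m M^T *m _]mulmxA trmx_inv mulmxV // mulmx1.
have -> : quad (invmx Mt) (A *m u) = quad (A *m invmx Mt *m A) u.
  by rewrite -[X in X *m _ *m _]As quad_congr.
rewrite -quad_congr -quadB smoother_adj e; congr (quad _ u).
rewrite /S /T -/Mi !(mulmxBr, mulmxDr, mulmxBl, mulmxDl) !(mulmxA, mulmx1).
by rewrite !mulNmx !opprD !opprK !addrA (addrAC A).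
Qed.

Lemma K_TG_best : best_upper
  (fun v => quad Mt (coarse_compl Mt P *m v)) (quad A) (K_TG A M P).
Proof.
set Zt := coarse_compl Mt P.
have ZtMs : (Zt^T *m Mt *m Zt)^T = Zt^T *m Mt *m Zt.
  exact/sym_congr/hMt.1.
have [t [tb [v0 v00 tv]]] := best_upper_rayleigh n0 ZtMs hA.
have quadE v : quad (Zt^T *m Mt *m Zt) v = quad Mt (Zt *m v).
  exact: quad_congr.
have pMt := spd_psd hMt.
suff -> : K_TG A M P = t by split=> [v|s hs]; [rewrite -quadE; exact: tb.1 |
  by apply: tb.2 => v; rewrite quadE].
have ratio v : vnorm Mt ((1%:M - PiMtilde A M P) *m v) ^+ 2 / vnorm A v ^+ 2 =
    quad (Zt^T *m Mt *m Zt) v / quad A v.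
  rewrite quadE /vnorm -/(quad Mt (Zt *m v)) -/(quad A v).
  by rewrite !sqr_sqrtr ?(pMt.2, pA.2).
apply: set_maxE => [|_ [v /= vn0 <-]].
  exists v0; rewrite // ratio (eigen_rayleigh tv) mulfK // gt_eqF //.
  exact: hA.2.
by rewrite ratio ler_pdivrMr; [exact: tb.1 | exact: hA.2].
Qed.

Lemma K_TG_gt0 : 0 < K_TG A M P.
Proof.
have [u u0 Pu] := coarse_ker.
have := lt_le_trans (hA.2 _ u0) ((coarse_compl_dual _ hMt).1 K_TG_best.1 u Pu).
rewrite pmulr_lgt0 //; apply: (spd_inv hMt).2.
by apply: contraNN u0 => /eqP Au1; rewrite -(mulKmx Au u) Au1 mulmx0.
Qed.

(** By the dual form of [K_TG], [1 - 1 / K_TG] is the least [a] with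
    [|T u|^2 <= a |u|^2] whenever [P^T A u = 0], that is, the least bound for
    [T Z], where [Z] projects onto those [u]; the adjoint of [T Z] is
    [Z S]. *)
Lemma exact_two_grid_best :
  best_upper (fun v => quad A (Z *m (S *m v))) (quad A) (1 - 1 / K_TG A M P).
Proof.
have K0 := K_TG_gt0; have Zs : Z^T *m A = A *m Z by exact: coarse_compl_sym.
have Kle : forall u, P^T *m A *m u = 0 ->
    quad A (T *m u) <= (1 - 1 / K_TG A M P) * quad A u.
  move=> u Pu; have := (coarse_compl_dual _ hMt).1 K_TG_best.1 u Pu.
  rewrite quad_post mulrBl div1r mul1r -ler_pdivrMl //; lra.
suff best : best_upper (fun w => quad A (T *m Z *m w)) (quad A)
    (1 - 1 / K_TG A M P).
  have adj : (T *m Z)^T *m A = A *m (Z *m S).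
    by rewrite trmx_mul -mulmxA smoother_adj mulmxA Zs mulmxA.
  have [ub lst] := adjoint_best n0 n0 hA hA adj best.
  split=> [v|s hs]; first by rewrite mulmxA; exact: ub.
  by apply: lst => v; rewrite -mulmxA.
have PZ (w : 'cV[R]_n) : P^T *m A *m (Z *m w) = 0.
  by rewrite mulmxA coarse_compl_range // mul0mx.
split=> [w|s hs].
  rewrite /= -(mulmxA T); apply: le_trans (Kle _ (PZ w)) _.
  apply: ler_wpM2l; last exact: quad_coarse_compl_le.
  have [u u0 Pu] := coarse_ker; have := le_trans (pA.2 _) (Kle u Pu).
  by rewrite pmulr_lge0 //; exact: hA.2.
(* For [s < 1] the bound says that [1 / (1 - s)] is admissible for [K_TG]. *)
have [s_ge1|s_lt1] := leP 1 s.
  by apply: le_trans s_ge1; rewrite gerBl div1r invr_ge0 ltW.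
have s1_gt0 : 0 < 1 - s by rewrite subr_gt0.
rewrite lerBlDr -lerBlDl div1r -[1 - s]invrK lef_pV2 ?posrE ?invr_gt0 //.
apply: K_TG_best.2; apply/(coarse_compl_dual _ hMt) => u Pu.
rewrite ler_pdivlMl //.
have := hs u; rewrite /= -(mulmxA T) [Z *m u]coarse_compl_id // quad_post; lra.
Qed.

(** [1 - lambda_min] is the best bound for the postsmoother by [quad_post], and
    the presmoother is its adjoint. *)
Lemma presmoother_best :
  best_upper (fun v => quad A (S *m v)) (quad A)
    (1 - lambda_min (invmx Mt *m A)).
Proof.
have [ub lst] := lambda_min_best n0 (spd_inv hMt).1 (spd_inv hA).
rewrite invmxK in ub lst.
apply: (adjoint_best n0 n0 hA hA smoother_adj); split=> [u|s hs].
  by have := ub (A *m u); rewrite quad_inv_mul // quad_post; lra.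
rewrite lerBlDr -lerBlDl; apply: lst => y.
have := hs (invmx A *m y); rewrite quad_post mulKVmx // quad_inv //.
lra.
Qed.

(** [e = 1 - lambda_max] bounds the postsmoother [T] from below.  If [e > 0]
    then [T] is invertible, and for [v = T u] Cauchy-Schwarz in the energy
    product gives [|v|^4 = <S v, u>^2 <= |S v|^2 |u|^2 <= |S v|^2 |v|^2 / e]. *)
Lemma presmoother_lower v :
  (1 - lambda_max (invmx Mt *m A)) * quad A v <= quad A (S *m v).
Proof.
have [ub _] := lambda_max_best n0 (spd_inv hMt).1 (spd_inv hA).
rewrite invmxK in ub.
set e := 1 - _.
have Te u : e * quad A u <= quad A (T *m u).
  by have := ub (A *m u); rewrite quad_inv_mul // quad_post /e; lra.
have [e_gt0|e_le0] := ltP 0 e; last first.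
  by apply: le_trans _ (pA.2 _); apply: mulr_le0_ge0 => //; exact: pA.2.
have Tu : T \in unitmx.
  apply: unitmx_ker0 => u Tu0; apply/eqP/negPn/negP => u0.
  by have := Te u; rewrite Tu0 quad0 pmulr_rle0 // leNgt hA.2.
rewrite -(mulKVmx Tu v); move: (invmx T *m v) => u.
have adj : quad A (T *m u) = inner (A *m (S *m (T *m u))) u.
  by rewrite mulmxA -smoother_adj -mulmxA inner_mull trmxK.
have := cauchy_schwarz (S *m (T *m u)) u pA; rewrite -adj => cs.
have [N_gt0|N_le0] := ltP 0 (quad A (T *m u)); last first.
  apply: le_trans _ (pA.2 _); apply: mulr_ge0_le0 => //; exact: ltW.
rewrite -(ler_pM2r N_gt0) -mulrA -expr2.
apply: le_trans (ler_wpM2l (ltW e_gt0) cs) _; rewrite mulrCA ler_wpM2l //.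
exact: pA.2.
Qed.

(* The energy of the coarse part [PiA S v] of [S v]. *)
Let H : 'cV[R]_n -> R := fun v =>
  quad Ac (invmx Ac *m (P^T *m (A *m (S *m v)))).

Let X := invmx Mt *m A.

(** The nonzero spectrum of [Mt^-1 A PiA] is that of the pencil [(Hc, Ac)] on
    the coarse space, with [Hc = (A P)^T Mt^-1 (A P)]: for
    [J = Mt^-1 A P Ac^-1] and [L = P^T A], the products [J L] and [L J] share
    their nonzero eigenvalues.  The least of them bounds [T P], whose adjoint
    gives [H]. *)
Lemma coarse_part_best :
  best_upper H (quad A) (1 - lambda_min_pos (X *m PiA A P)).
Proof.
pose Hc := (A *m P)^T *m invmx Mt *m (A *m P).
have AP0 (w : 'cV[R]_nc) : A *m P *m w = 0 -> w = 0.
  rewrite -mulmxA => APw; apply: (full_rank_inj hP).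
  by rewrite -(mulKmx Au (P *m w)) APw mulmx0.
have hHc : spd Hc by exact: spd_congr AP0 (spd_inv hMt).
have quadHc w : quad Hc w = quad (invmx Mt) (A *m (P *m w)).
  by rewrite quad_congr mulmxA.
have adj : (T *m P)^T *m A = Ac *m (invmx Ac *m (P^T *m A *m S)).
  by rewrite trmx_mul mulKVmx // -!mulmxA smoother_adj.
have quadTP w : quad A (T *m P *m w) = quad Ac w - quad Hc w.
  by rewrite -mulmxA quad_post quadHc quad_coarse.
have eigenE l : (eigenvalue (X *m PiA A P) l /\ 0 < l) <->
    eigenvalue (Hc *m invmx Ac) l.
  have XE : X *m PiA A P = (invmx Mt *m A *m P *m invmx Ac) *m (P^T *m A).
    by rewrite /X /PiA -!mulmxA.
  have HE : Hc *m invmx Ac = (P^T *m A) *m (invmx Mt *m A *m P *m invmx Ac).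
    by rewrite /Hc trmx_mul hA.1 -!mulmxA.
  rewrite XE HE; set J := invmx Mt *m A *m P *m invmx Ac; set L := P^T *m A.
  split=> [[/eigenvalueP[u uJ u0] l0]|].
    have lu0 : l *: u != 0 by rewrite scaler_eq0 negb_or gt_eqF.
    apply/eigenvalueP; exists (u *m J).
      by rewrite (mulmxA (u *m J) L) -(mulmxA u J L) uJ scalemxAl.
    by apply: contraNN lu0 => /eqP uJ0; rewrite -uJ (mulmxA u J) uJ0 mul0mx.
  move=> el; split; last first.
    move: el; rewrite -HE.
    move=> /(eigenvalue_pencil _ hHc.1 hAc)[v v0 /eigen_rayleigh].
    have := hHc.2 v v0; rewrite -/(quad Hc v) => + qE; rewrite qE pmulr_lgt0 //.
    exact: hAc.2.
  move: el => /eigenvalueP[y yJ y0]; apply/eigenvalueP; exists (y *m L).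
    by rewrite (mulmxA (y *m L) J) -(mulmxA y L J) yJ scalemxAl.
  apply: contraNN y0 => /eqP yPA.
  rewrite -(mulmxK Acu y) /Ac /coarse_mx (mulmxA y) yPA mul0mx mul0mx.
  exact: eqxx.
have [ub lst] := min_eigen_best hnc0 hHc.1 hAc eigenE.
suff best : best_upper (fun w => quad A (T *m P *m w)) (quad Ac)
    (1 - lambda_min_pos (X *m PiA A P)).
  have [ub' lst'] := adjoint_best hnc0 n0 hAc hA adj best.
  have HE v : H v = quad Ac (invmx Ac *m (P^T *m A *m S) *m v).
    by rewrite /H; congr (quad _ _); rewrite -!mulmxA.
  by split=> [v|s hs]; [rewrite HE; exact: ub' | apply: lst' => v; rewrite -HE].
split=> [w|s hs].
  by rewrite quadTP; have := ub w; rewrite /lambda_min_pos; lra.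
rewrite lerBlDr -lerBlDl; apply: lst => w.
by have := hs w; rewrite quadTP; lra.
Qed.

End TwoGrid.

(** * The iteration matrix *)

Section IterationMatrix.
Set Implicit Arguments.
Unset Strict Implicit.
Unset Printing Implicit Defensive.
Variables (R : realType) (n nc : nat).
Variables (A M : 'M[R]_n) (P : 'M[R]_(n, nc)) (Bc : 'M[R]_nc).
Hypotheses (hA : spd A) (hBc : spd Bc).
Hypotheses (hnc0 : (0 < nc)%N) (hP : \rank P = nc).

Let S : 'M[R]_n := 1%:M - invmx M *m A.
Let T : 'M[R]_n := 1%:M - (invmx M)^T *m A.
Let E := E_ITG A M P Bc.

Lemma E_ITG_form :
  A *m E = S^T *m (A - (P^T *m A)^T *m invmx Bc *m (P^T *m A)) *m S.
Proof.
have AT : A *m T = S^T *m A.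
  by rewrite -[A *m T]trmxK trmx_mul hA.1 smoother_adj // trmx_mul hA.1.
rewrite /E /E_ITG -/S -/T -(mulmxA T) mulmxA AT -!mulmxA; congr (_ *m _).
by rewrite mulmxBl mulmxBl mul1mx mulmxBr trmx_mul trmxK hA.1 !mulmxA.
Qed.

Lemma E_ITG_selfadjoint : (A *m E)^T = A *m E.
Proof.
rewrite E_ITG_form; apply: sym_congr; rewrite linearB /= hA.1.
by rewrite sym_congr // (spd_inv hBc).1.
Qed.

Lemma quad_E_ITG v : quad (A *m E) v =
  quad A (S *m v) - quad (invmx Bc) (P^T *m (A *m (S *m v))).
Proof. by rewrite E_ITG_form quad_congr quadB quad_congr -mulmxA. Qed.

(** If [S] is invertible this is the preimage of a coarse vector, otherwise a
    kernel vector of [S]; the rank of [(I - PiA) S] covers both. *)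
Lemma coarse_range_vector :
  exists2 v : 'cV[R]_n, v != 0 & coarse_compl A P *m (S *m v) = 0.
Proof.
have /singularP rkZ : exists2 u : 'cV[R]_n, u != 0 & coarse_compl A P *m u = 0.
  exists (P *m delta_mx (Ordinal hnc0) 0).
    apply/eqP => /(full_rank_inj hP)/eqP; apply/negP; exact: delta_neq0.
  by rewrite mulmxA coarse_compl_coarse // mul0mx.
have /singularP[v v0 Zv] : (\rank (coarse_compl A P *m S) < n)%N.
  exact: leq_ltn_trans (mxrankM_maxl _ _) rkZ.
by exists v; rewrite // mulmxA.
Qed.

End IterationMatrix.

(** * Combining the inequalities *)

Section Bounds.
Set Implicit Arguments.
Unset Strict Implicit.
Unset Printing Implicit Defensive.
Variables (R : realType) (V : Type) (N G H F : V -> R).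
Variables (r1 r2 a c d e t : R).
Hypotheses (r1_ge0 : 0 <= r1) (r12 : r1 <= r2).
Hypothesis N_ge0 : forall v, 0 <= N v.
Hypothesis H_ge0 : forall v, 0 <= H v.
Hypothesis H_le : forall v, H v <= G v.
Hypothesis F_ge : forall v, G v - r2 * H v <= F v.
Hypothesis F_le : forall v, F v <= G v - r1 * H v.
Hypothesis best_a : best_upper (fun v => G v - H v) N a.
Hypothesis best_c : best_upper H N c.
Hypothesis best_d : best_upper G N d.
Hypothesis e_le : forall v, e * N v <= G v.
Hypothesis best_t : best_upper (fun v => `|F v|) N t.
Hypothesis exH0 : exists2 v, 0 < N v & H v = 0.
Hypothesis exHG : exists2 v, 0 < N v & H v = G v.

Lemma F_bound v : - (t * N v) <= F v <= t * N v.
Proof. by rewrite -ler_norml; exact: best_t.1. Qed.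

Lemma upper_of_bounds s s' :
  (forall v, F v <= s * N v) -> (forall v, - F v <= s' * N v) ->
  t <= Num.max s s'.
Proof.
move=> hs hs'; apply: best_t.2 => v; rewrite ler_norml lerNl.
by apply/andP; split; [apply: le_trans (hs' v) _ | apply: le_trans (hs v) _];
  rewrite ler_wpM2r // le_max lexx ?orbT.
Qed.

Lemma F_le_U1 v : r1 <= 1 -> F v <= (r1 * a + (1 - r1) * d) * N v.
Proof.
move=> r1le; have r1' : 0 <= 1 - r1 by lra.
have := F_le v; have := ler_wpM2l r1_ge0 (best_a.1 v).
have := ler_wpM2l r1' (best_d.1 v) => /=; lra.
Qed.

Lemma opp_F_le_U2 v : 1 <= r2 -> - F v <= (r2 - 1) * c * N v.
Proof.
move=> r2ge; have r2' : 0 <= r2 - 1 by lra.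
have := F_ge v; have := ler_wpM2l r2' (best_c.1 v); have := H_le v => /=; lra.
Qed.

Lemma bounds_small : r2 <= 1 ->
  [/\ a <= t, d - r2 * c <= t & t <= r1 * a + (1 - r1) * d].
Proof.
move=> r2le; have r2_ge0 : 0 <= r2 by exact: le_trans r1_ge0 r12.
have F_ge' v : G v - H v <= F v.
  have r2' : 0 <= 1 - r2 by lra.
  by have := F_ge v; have := mulr_ge0 r2' (H_ge0 v) => /=; lra.
split.
- apply: best_a.2 => v; have /andP[_] := F_bound v.
  by have := F_ge' v => /=; lra.
- rewrite lerBlDr; apply: best_d.2 => v; have /andP[_] := F_bound v.
  by have := F_ge v; have := ler_wpM2l r2_ge0 (best_c.1 v) => /=; lra.
apply: best_t.2 => v; rewrite ger0_norm.
  exact: F_le_U1 (le_trans r12 r2le).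
by apply: le_trans (F_ge' v); rewrite subr_ge0.
Qed.

(** The bound by [e] evaluates [F] where the coarse part vanishes, so that
    [F = G]; the other one comes from
    [r2 (G - H) = (G - r2 H) + (r2 - 1) G]. *)
Lemma lower_large : 1 < r2 -> e <= t /\ r2 * a - (r2 - 1) * d <= t.
Proof.
move=> r2gt; have r2_gt0 : 0 < r2 by lra.
have r2' : 0 <= r2 - 1 by lra.
split.
  have [v Nv Hv] := exH0; rewrite -(ler_pM2r Nv).
  have /andP[_] := F_bound v; have := F_ge v; have := e_le v.
  by rewrite Hv => /=; lra.
rewrite lerBlDr -ler_pdivlMl //; apply: best_a.2 => v.
rewrite -mulrA ler_pdivlMl //; have /andP[_] := F_bound v.
by have := F_ge v; have := ler_wpM2l r2' (best_d.1 v) => /=; lra.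
Qed.

(** For [r1 > 1] the coarse correction overshoots and [- F] can be positive:
    [r1 H = (r1 H - G) + G], and [- F >= (r1 - 1) G] where [H = G]. *)
Lemma lower_over : 1 < r1 -> r1 * c - d <= t /\ (r1 - 1) * e <= t.
Proof.
move=> r1gt; have r1_gt0 : 0 < r1 by lra.
have r1' : 0 <= r1 - 1 by lra.
split.
  rewrite lerBlDr -ler_pdivlMl //; apply: best_c.2 => v.
  rewrite -mulrA ler_pdivlMl //; have /andP[+ _] := F_bound v.
  by have := F_le v; have := best_d.1 v => /=; lra.
have [v Nv Hv] := exHG; rewrite -(ler_pM2r Nv).
have /andP[+ _] := F_bound v; have := F_le v; rewrite Hv.
have := ler_wpM2l r1' (e_le v) => /=; lra.
Qed.

Lemma upper_mid : r1 <= 1 -> 1 < r2 ->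
  t <= Num.max (r1 * a + (1 - r1) * d) ((r2 - 1) * c).
Proof.
move=> r1le r2gt; apply: upper_of_bounds => v; first exact: F_le_U1.
by apply: opp_F_le_U2; exact: ltW.
Qed.

Lemma upper_over : 1 < r1 -> t <= Num.max a ((r2 - 1) * c).
Proof.
move=> r1gt; apply: upper_of_bounds => v; last first.
  exact: opp_F_le_U2 (le_trans (ltW r1gt) r12).
have r1' : 0 <= r1 - 1 by lra.
have := best_a.1 v; have := F_le v; have := mulr_ge0 r1' (H_ge0 v) => /=; lra.
Qed.

End Bounds.

Theorem theorem3p2 (R : realType) (n nc : nat)
    (A M : 'M[R]_n) (P : 'M[R]_(n, nc)) (Bc : 'M[R]_nc)
    (hA : spd A) (hM : M \in unitmx) (hMA : spd (M + M^T - A))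
    (hnc0 : (0 < nc)%N) (hnc : (nc < n)%N) (hP : \rank P = nc) (hBc : spd Bc) :
  let Ac := coarse_mx A P in
  let r1 := lambda_min (invmx Bc *m Ac) in
  let r2 := lambda_max (invmx Bc *m Ac) in
  let K := K_TG A M P in
  let X := invmx (Mtilde A M) *m A in
  let lmin := lambda_min X in
  let lmax := lambda_max X in
  let lpos := lambda_min_pos (X *m PiA A P) in
  let E := mnorm A (E_ITG A M P Bc) in
  let L1 := 1 - Num.min (1 / K) (lmin + r2 * (1 - lpos)) in
  let U1 := 1 - r1 / K - (1 - r1) * lmin in
  let L2 := 1 - Num.min lmax (r2 / K - (r2 - 1) * lmin) in
  let U2 := (r2 - 1) * (1 - lpos) in
  let L3 := r1 - 1 - Num.min (r1 * lpos - lmin) ((r1 - 1) * lmax) in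
  let U3 := Num.max (1 - 1 / K) ((r2 - 1) * (1 - lpos)) in
  [/\ r2 <= 1 -> L1 <= E /\ E <= U1,
      r1 <= 1 /\ 1 < r2 -> L2 <= E /\ E <= Num.max U1 U2
    & 1 < r1 -> Num.max L2 L3 <= E /\ E <= U3].
Proof.
move=> Ac r1 r2 K X lmin lmax lpos E L1 U1 L2 U2 L3 U3.
have n0 := ltn_trans hnc0 hnc; have pA := spd_psd hA.
have hAc : spd Ac := coarse_spd hA hP; have iAc := spd_inv hAc.
have iBc := spd_psd (spd_inv hBc).
pose y (v : 'cV[R]_n) := P^T *m (A *m ((1%:M - invmx M *m A) *m v)).
pose G v := quad A ((1%:M - invmx M *m A) *m v).
pose H v := quad Ac (invmx Ac *m y v).
have [r1b r1g] := lambda_min_best hnc0 iBc.1 iAc.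
have [r2b _] := lambda_max_best hnc0 iBc.1 iAc.
rewrite invmxK -/r1 in r1b r1g; rewrite invmxK -/r2 in r2b.
have r1_ge0 : 0 <= r1 by apply: r1g => w; rewrite mul0r; exact: iBc.2.
have r12 : r1 <= r2.
  have := le_trans (r1b _) (r2b (delta_mx (Ordinal hnc0) 0)).
  by rewrite ler_pM2r //; apply: iAc.2; exact: delta_neq0.
have N_ge0 := pA.2.
have H_ge0 v : 0 <= H v by exact: (spd_psd hAc).2.
have GH v :
    G v - H v = quad A (coarse_compl A P *m ((1%:M - invmx M *m A) *m v)).
  by rewrite quad_coarse_compl.
have H_le v : H v <= G v by rewrite -subr_ge0 GH.
have F_ge v : G v - r2 * H v <= quad (A *m E_ITG A M P Bc) v.
  by rewrite quad_E_ITG // lerB // /H quad_inv.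
have F_le v : quad (A *m E_ITG A M P Bc) v <= G v - r1 * H v.
  by rewrite quad_E_ITG // lerB // /H quad_inv.
have best_a : best_upper (fun v => G v - H v) (quad A) (1 - 1 / K).
  have [ub lst] := exact_two_grid_best hA hM hMA hnc0 hnc hP.
  by split=> [v|s hs]; [rewrite GH; exact: ub | apply: lst => v; rewrite -GH].
have best_c : best_upper H (quad A) (1 - lpos).
  exact: coarse_part_best.
have best_d : best_upper G (quad A) (1 - lmin).
  exact: presmoother_best hnc0 hnc.
have e_le v : (1 - lmax) * quad A v <= G v.
  exact: presmoother_lower hnc0 hnc _.
have best_t := mnorm_selfadjoint n0 hA (E_ITG_selfadjoint M P hA hBc).
have exH0 : exists2 v, 0 < quad A v & H v = 0.
  have /singularP[v v0 yv] : (\rank (P^T *m A *m (1%:M - invmx M *m A)) < n)%N.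
    by apply: leq_ltn_trans hnc; exact: rank_leq_row.
  exists v; first exact: hA.2.
  have -> : H v = quad Ac (invmx Ac *m 0) by rewrite -yv /H /y !mulmxA.
  by rewrite mulmx0 quad0.
have exHG : exists2 v, 0 < quad A v & H v = G v.
  have [v v0 Zv] := coarse_range_vector M hA hnc0 hP.
  exists v; first exact: hA.2.
  by apply/esym/eqP; rewrite -subr_eq0 GH Zv quad0.
have U1E : r1 * (1 - 1 / K) + (1 - r1) * (1 - lmin) = U1.
  by rewrite /U1 div1r; ring.
rewrite -/E in best_t.
have L2E : 1 < r2 -> L2 <= E.
  move=> r2gt.
  have [h1 h2] := lower_large F_ge best_a best_d e_le best_t exH0 r2gt.
  rewrite /L2 lerBlDr -lerBlDl le_min; apply/andP; split; first by lra.
  by move: h2; rewrite div1r; lra.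
split=> [r2le|[r1le r2gt]|r1gt].
- have [] := bounds_small r1_ge0 r12 H_ge0 H_le F_ge F_le
    best_a best_c best_d best_t r2le.
  rewrite U1E => h1 h2 h3; split=> //.
  by rewrite /L1 lerBlDr -lerBlDl le_min; apply/andP; split; lra.
- split; first exact: L2E.
  rewrite -U1E.
  exact: upper_mid r1_ge0 N_ge0 H_le F_ge F_le best_a best_c best_d best_t _ _.
- split; last first.
    exact: upper_over r12 N_ge0 H_ge0 H_le F_ge F_le best_a best_c best_t _.
  rewrite ge_max L2E ?(lt_le_trans r1gt) //=.
  have [h1 h2] := lower_over F_le best_c best_d e_le best_t exHG r1gt.
  by rewrite /L3 lerBlDr -lerBlDl le_min; apply/andP; split; lra.
Qed.
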